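(* For any integers $r,t\ge1$, any real $a\in(3/2,2]$ and any $\gamma>0$, there exists $n_0$ such that for all $n\ge n_0$, every digraph $G$ on $n$ vertices with $e_a(G)\ge a\,t_r(n)+\gamma n^2$ contains $T_{r+1}^t$ as a subdigraph.
   Context: A digraph is a set of vertices with a set of ordered pairs of distinct vertices (arcs). For a digraph $G$, $f_1(G)$ is the number of unordered pairs $\{u,v\}$ such that exactly one of $uv,vu$ is an arc, and $f_2(G)$ is the number of unordered pairs with both $uv$ and $vu$ arcs; for real $a\ge1$, $e_a(G)=a f_2(G)+f_1(G)$. $t_r(n)$ is the number of edges of the $r$-partite Turán graph on $n$ vertices (complete $r$-partite graph with parts as equal as possible). $T_{r+1}$ is the transitive tournament on $r+1$ vertices, and $T_{r+1}^t$ is obtained from $T_{r+1}$ by replacing each vertex by an independent set of size $t$ and adding all arcs from the $i$-th set to the $j$-th set whenever $ij$ is an arc of $T_{r+1}$. *)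

(* Defs.v *)
From HB Require Import structures.
From mathcomp Require Import all_boot all_order all_algebra.
From mathcomp Require Import reals.

Set Implicit Arguments.
Unset Strict Implicit.
Unset Printing Implicit Defensive.

Import Order.TTheory GRing.Theory Num.Theory.

Record digraph := Digraph {
  vertex : finType;
  arc : rel vertex;
  arc_irrefl : irreflexive arc
}.

(* Unordered pairs {u, v} are represented by the sets [set u; v] with u != v. *)
Definition single_pairs (G : digraph) : {set {set vertex G}} :=
  [set A : {set vertex G} | [exists u : vertex G, exists v : vertex G,
     [&& u != v, A == [set u; v] & arc u v (+) arc v u]]].

Definition double_pairs (G : digraph) : {set {set vertex G}} :=
  [set A : {set vertex G} | [exists u : vertex G, exists v : vertex G,
     [&& u != v, A == [set u; v] & arc u v && arc v u]]].

Definition f1 (G : digraph) : nat := #|single_pairs G|.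

Definition f2 (G : digraph) : nat := #|double_pairs G|.

Definition weight (R : realType) (a : R) (G : digraph) : R :=
  (a * (f2 G)%:R + (f1 G)%:R)%R.

(* The parts of the r-partite Turan graph on {0, ..., n-1} are the residue
   classes mod r, whose sizes differ by at most one (for 0 < r). *)
Definition turan_adj (r n : nat) : rel 'I_n :=
  fun i j => i %% r != j %% r.

Definition turan_edges (r n : nat) : {set {set 'I_n}} :=
  [set A : {set 'I_n} | [exists i : 'I_n, exists j : 'I_n,
     (A == [set i; j]) && turan_adj r i j]].

Definition turan_number (r n : nat) : nat := #|turan_edges r n|.

Lemma ltn_ord_irrefl (k : nat) : irreflexive (fun i j : 'I_k => i < j).
Proof. by move=> i; rewrite /= ltnn. Qed.

Definition transitive_tournament (k : nat) : digraph :=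
  Digraph (@ltn_ord_irrefl k).

Lemma blowup_irrefl (H : digraph) (t : nat) :
  irreflexive (fun x y : vertex H * 'I_t => arc x.1 y.1).
Proof. by move=> x; rewrite /= arc_irrefl. Qed.

Definition blowup (H : digraph) (t : nat) : digraph :=
  Digraph (@blowup_irrefl H t).

(* H is a (not necessarily induced) subdigraph of G, up to isomorphism. *)
Definition contains (G H : digraph) : Prop :=
  exists2 f : vertex H -> vertex G,
    injective f & forall x y : vertex H, arc x y -> arc (f x) (f y).

(* Main.v *)
(* Insert the vertices into a list one at a time in uniformly random order,
   putting v in front if all earlier vertices are out-neighbours of v, at the
   end if they are all in-neighbours, and skipping v otherwise: the list is a
   transitive tournament.  If v has p non-out-neighbours and q
   non-in-neighbours (v included) and s vertices are of one of these kinds,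
   then v is inserted with probability 1/p + 1/q - 1/s, which for a >= 3/2 is
   at least 1/(n - d(v)/a), d(v) being the weighted degree.  Summing over v, a
   digraph without T_{r+1} has e_a <= a (1 - 1/r) n^2 / 2.  Applied to random
   samples of bounded size, this gives a positive density of copies of T_{r+1}
   as soon as the weight is larger by gamma n^2, and a Kovari-Sos-Turan argument
   (Erdos, for (r+1)-partite hypergraphs) turns positive density into a
   blow-up. *)
Require Import Defs.
From mathcomp Require Import all_boot all_order all_algebra all_fingroup.
From mathcomp Require Import reals ring lra zify.

Import Order.TTheory GRing.Theory Num.Theory.
Local Open Scope ring_scope.

(** * Ordered and unordered pairs *)

(** Each edge comes from exactly two ordered pairs. This turns [f1], [f2] and the Turan number into
    halves of sums over ordered pairs. *)
Lemma card_unordered_pairs (T : finType) (e : rel T) :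
  symmetric e -> irreflexive e ->
  #|[set p : T * T | e p.1 p.2]| =
    (#|[set A : {set T} | [exists u, exists v, (A == [set u; v]) && e u v]]|
       * 2)%N.
Proof.
move=> e_sym e_irr; set E := [set A : {set T} | _].
rewrite -sum1_card (partition_big (fun p => [set p.1; p.2]) (mem E)) /=; last first.
  move=> [u v]; rewrite !inE /= => euv.
  by apply/existsP; exists u; apply/existsP; exists v; rewrite eqxx.
rewrite -sum_nat_const; apply: eq_bigr => A.
rewrite inE => /existsP[u /existsP[v /andP[/eqP -> euv]]].
have uv : u != v by apply/eqP => uv; rewrite uv e_irr in euv.
rewrite (eq_bigl (mem [set (u, v); (v, u)])) ?sum1_card ?cards2 ?xpair_eqE ?(negbTE uv) //.
move=> [x y]; rewrite !inE /= !xpair_eqE; apply/andP/orP.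
  case=> exy /eqP/setP Exy.
  have xy : x != y by apply/eqP => xy; rewrite xy e_irr in exy.
  have := Exy x; have := Exy y; rewrite !inE !eqxx orbT /=.
  move=> /esym/orP[]/eqP yE /esym/orP[]/eqP xE.
  - by rewrite xE yE eqxx in xy.
  - by right; rewrite xE yE !eqxx.
  - by left; rewrite xE yE !eqxx.
  - by rewrite xE yE eqxx in xy.
by case=> /andP[/eqP -> /eqP ->]; rewrite ?euv ?(e_sym v u) ?euv // setUC.
Qed.

(** * Random insertion orders and the weight of digraphs without large transitive tournaments *)

(** A uniform permutation [s] followed by [enum_rank] gives the arrival times of a uniformly random
    order. *)
Definition earliest {T : finType} (W : {set T}) (v : T) (s : {perm T}) :=
  [forall u in W, enum_rank (s v) <= enum_rank (s u)]%N.

(* Composing with the transposition of u and v exchanges the events that u and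
   that v come first in W. *)
Lemma card_earliest (T : finType) (W : {set T}) (v : T) : v \in W ->
  (#|W| * #|[set s | earliest W v s]| = #|{: {perm T}}|)%N.
Proof.
move=> vW.
have swap u : u \in W -> #|[set s | earliest W u s]| = #|[set s | earliest W v s]|.
  move=> uW; rewrite -[RHS](card_imset _ (mulgI (tperm u v))).
  apply: eq_card => s; rewrite !inE; apply/idP/imsetP; last first.
    case=> s' + ->; rewrite !inE => /forall_inP h; apply/forall_inP => x xW.
    rewrite !permM tpermL; apply: h.
    by case: tpermP => // ->.
  move=> /forall_inP h; exists (tperm u v * s)%g; last by rewrite mulgA tperm2 mul1g.
  rewrite !inE; apply/forall_inP => x xW.
  rewrite !permM tpermR; apply: h.
  by case: tpermP => // ->.
rewrite -sum_nat_const -(eq_bigr _ swap) -[RHS]sum1_card.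
under eq_bigr do rewrite -sum1_card.
under eq_bigr do under eq_bigl do rewrite inE.
rewrite (exchange_big_dep predT) //=; apply: eq_bigr => s _.
pose u := [arg min_(u < v in W) enum_rank (s u)].
have [uW umin] : u \in W /\
    forall x, x \in W -> (enum_rank (s u) <= enum_rank (s x))%N.
  by rewrite /u; case: arg_minnP.
rewrite (big_pred1 u) // => x; apply/andP/eqP => [[xW /forall_inP xmin]|->].
  apply: (@perm_inj _ s); apply: enum_rank_inj; apply/val_inj/eqP.
  by rewrite eqn_leq umin ?xmin.
by split=> //; apply/forall_inP.
Qed.

(** Remove the last arrival: the rest of [S] can be ordered by induction, and the removed vertex,
    having arcs to all of it or from all of it, goes to the front or to the end. *)
Lemma pairwise_of_insertions (T : finType) (e : rel T) (rk : T -> nat)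
    (S : {set T}) : injective rk ->
  (forall v, v \in S ->
     (forall u, u \in S -> (rk u < rk v)%N -> e v u) \/
     (forall u, u \in S -> (rk u < rk v)%N -> e u v)) ->
  exists2 s : seq T, pairwise e s & perm_eq s (enum S).
Proof.
move=> rk_inj; have [k] := ubnP #|S|; elim: k S => // k IHk S ltk hS.
have [->|[x0 x0S]] := set_0Vmem S; first by exists [::]; rewrite ?enum_set0.
pose v := [arg max_(v > x0 in S) rk v].
have [vS vmax] : v \in S /\ forall x, x \in S -> (rk x <= rk v)%N.
  by rewrite /v; case: arg_maxnP.
have [||s es sS] := IHk (S :\ v).
- by move: ltk; rewrite (cardsD1 v S) vS.
- move=> u /setD1P[_ uS]; case: (hS u uS) => h; [left|right] => x /setD1P[_ xS];
    exact: h.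
have mem_s : s =i S :\ v by move=> x; rewrite (perm_mem sS) mem_enum.
have sv x : x \in s -> x \in S /\ (rk x < rk v)%N.
  rewrite mem_s => /setD1P[xv xS]; split=> //.
  by rewrite ltn_neqAle vmax // andbT (inj_eq rk_inj).
have uniqv : uniq (v :: s).
  by rewrite /= mem_s !inE eqxx /= (perm_uniq sS) enum_uniq.
have vsS : perm_eq (v :: s) (enum S).
  apply: uniq_perm => //; first exact: enum_uniq.
  by move=> x; rewrite inE mem_s mem_enum !inE; case: eqP => // ->.
case: (hS v vS) => h.
  exists (v :: s) => //=; rewrite es andbT; apply/allP => x /sv[xS]; exact: h.
exists (rcons s v); last by rewrite (perm_trans _ vsS) // perm_rcons.
rewrite pairwise_rcons es andbT; apply/allP => x /sv[xS]; exact: h.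
Qed.

(* The tangent at tau to the convex bound 1/D on the insertion probability,
   where D = n - d(v)/a; being affine in d(v), it can be summed over v. *)
Lemma insertion_prob_ge (R : realFieldType) (a p q s tau : R) :
  3 / 2 <= a -> 0 < tau -> 0 < p <= s -> 0 < q <= s -> s < p + q ->
  2 / tau - ((a - 2) * s + p + q) / a / tau ^+ 2 <= p^-1 + q^-1 - s^-1.
Proof.
move=> ha tau0 /andP[p0 ps] /andP[q0 qs] spq.
have s0 : 0 < s by apply: lt_le_trans ps.
(* The value of ((a - 2) s + p + q) / a at a = 3/2; since p + q <= 2 s, this quotient is
   nondecreasing in a. *)
pose D := (2 * (p + q) - s) / 3.
have D0 : 0 < D by rewrite /D; lra.
have DE : D <= ((a - 2) * s + p + q) / a.
  rewrite ler_pdivlMr; last lra.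
  rewrite /D; nra.
apply: (@le_trans _ _ (2 / tau - D / tau ^+ 2)).
  by rewrite lerD2l lerN2 ler_pM2r // invr_gt0 exprn_gt0.
apply: (@le_trans _ _ D^-1).
  rewrite -subr_ge0.
  have -> : D^-1 - (2 / tau - D / tau ^+ 2) = (tau - D) ^+ 2 / (D * tau ^+ 2).
    by field; rewrite !gt_eqF.
  by rewrite divr_ge0 ?sqr_ge0 // mulr_ge0 ?sqr_ge0 // ltW.
rewrite -subr_ge0.
have D3 : 0 < 2 * (p + q) - s by lra.
have -> : p^-1 + q^-1 - s^-1 - D^-1 =
  ((s * (p + q) - p * q) * (2 * (p + q) - s) - 3 * p * q * s) /
  (p * q * s * (2 * (p + q) - s)).
  by rewrite /D; field; rewrite !gt_eqF.
apply: divr_ge0; last by rewrite !mulr_ge0 // ltW.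
(* In these nonnegative slacks, with s = x + d, the numerator becomes a sum of nonnegative terms. *)
pose x := p + q - s; pose d := 2 * s - p - q.
have x0 : 0 <= x by rewrite /x; lra.
have d0 : 0 <= d by rewrite /d; lra.
have -> : (s * (p + q) - p * q) * (2 * (p + q) - s) - 3 * p * q * s =
  d * x ^+ 2 + x * d ^+ 2 / 2 + (p - q) ^+ 2 / 4 * (6 * x + 4 * d).
  by rewrite /x /d; field.
have sq4 : 0 <= (p - q) ^+ 2 / 4 by rewrite divr_ge0 ?sqr_ge0.
have xd : 0 <= x * d ^+ 2 / 2 by rewrite divr_ge0 ?mulr_ge0 ?sqr_ge0.
by rewrite addr_ge0 ?addr_ge0 // mulr_ge0 ?sqr_ge0 //; lra.
Qed.

(* The value is a on double arcs, 1 on single arcs and 0 on non-adjacent pairs,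
   in a form that is linear in the out-, in- and double degrees. *)
Definition arc_weight {R : pzRingType} {T : finType} (e : rel T)
    (a : R) (u v : T) : R :=
  (a - 2) * (e u v && e v u)%:R + (e u v)%:R + (e v u)%:R.

Lemma sum_natr_pred (R : pzRingType) (T : finType) (P : pred T) :
  \sum_u (P u)%:R = #|[set u | P u]|%:R :> R.
Proof.
rewrite -natr_sum -sum1_card [in RHS]big_mkcond /=; congr _%:R.
by apply: eq_bigr => u _; rewrite inE; case: (P u).
Qed.

Lemma sum_arc_weight_le (R : realFieldType) (T : finType) (e : rel T) (a : R)
    (r : nat) : irreflexive e -> 3 / 2 <= a -> (0 < r)%N ->
  (forall s, pairwise e s -> (size s <= r)%N) ->
  \sum_u \sum_v arc_weight e a u v <= a * (1 - r%:R^-1) * #|T|%:R ^+ 2.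
Proof.
move=> e_irr ha r0 hs.
have [T0|T0] := posnP #|T|.
  rewrite big1 => [|u]; last by have := max_card (pred1 u); rewrite card1 T0.
  by rewrite T0 expr0n mulr0.
pose n : R := #|T|%:R; have n0 : 0 < n by rewrite ltr0n.
have r0' : 0 < r%:R :> R by rewrite ltr0n.
(* n/r is the value of n - d(v)/a at every vertex of a balanced complete r-partite digraph with all
   arcs double, so the tangent loses nothing in the extremal case. *)
pose tau := n / r%:R; have tau0 : 0 < tau by rewrite divr_gt0.
have a0 : 0 < a by lra.
pose O v := [set u | ~~ e v u]; pose I v := [set u | ~~ e u v].
have vO v : v \in O v by rewrite inE e_irr.
have vI v : v \in I v by rewrite inE e_irr.
(* [v] is compared with all earlier arrivals, not only the selected ones, so its selection depends
   only on who comes first in [O v] and in [I v]. *)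
pose sel s := [set v | earliest (O v) v s || earliest (I v) v s].
have le_sel s : (#|sel s| <= r)%N.
  pose rk v := nat_of_ord (enum_rank (s v)).
  have [|v|l el] := @pairwise_of_insertions _ e rk (sel s).
  - by move=> u v /val_inj/enum_rank_inj/perm_inj.
  - rewrite inE => /orP[]/forall_inP h; [left|right] => u _; rewrite ltnNge;
      apply: contraNT => ne; apply: h; by rewrite inE.
  by move/perm_size; rewrite -cardE => <-; apply: hs.
pose K : R := #|{: {perm T}}|%:R.
have K0 : 0 < K by rewrite ltr0n; apply/card_gt0P; exists 1%g.
have prob (W : {set T}) v : v \in W -> 0 < #|W|%:R :> R /\
    #|[set s | earliest W v s]|%:R = K / #|W|%:R :> R.
  move=> vW; have W0 : 0 < #|W|%:R :> R by rewrite ltr0n; apply/card_gt0P; exists v.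
  by split=> //; rewrite /K -(card_earliest _ _ _ vW) natrM mulrC mulKf ?gt_eqF.
have sum_w v : \sum_u arc_weight e a v u =
    (a - 2) * (n - #|O v :|: I v|%:R) + (n - #|O v|%:R) + (n - #|I v|%:R).
  rewrite /arc_weight !big_split /= -mulr_sumr !sum_natr_pred.
  have nC (W : {set T}) : n - #|W|%:R = #|~: W|%:R.
    by rewrite /n -(cardsC W) natrD addrC addKr.
  rewrite !nC.
  have -> : ~: (O v :|: I v) = [set u | e v u && e u v].
    by apply/setP => u; rewrite !inE negb_or !negbK.
  have -> : ~: O v = [set u | e v u] by apply/setP => u; rewrite !inE negbK.
  have -> : ~: I v = [set u | e u v] by apply/setP => u; rewrite !inE negbK.
  by [].
have sel_v v : K * (2 / tau - (n - (\sum_u arc_weight e a v u) / a) / tau ^+ 2) <=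
    #|[set s | v \in sel s]|%:R.
  have -> : [set s | v \in sel s] =
      [set s | earliest (O v) v s] :|: [set s | earliest (I v) v s].
    by apply/setP => s; rewrite !inE.
  (* Inclusion-exclusion: being first in both sets means being first in their union, whence the term
     -1/s. *)
  have cI : [set s | earliest (O v) v s] :&: [set s | earliest (I v) v s] =
      [set s | earliest (O v :|: I v) v s].
    apply/setP => s; rewrite !inE; apply/andP/forall_inP.
      move=> [/forall_inP h1 /forall_inP h2] u.
      by move=> /setUP[]; [apply: h1|apply: h2].
    by move=> h; split; apply/forall_inP => u hu; apply: h; rewrite inE hu ?orbT.
  have [p0 pE] := prob _ _ (vO v); have [q0 qE] := prob _ _ (vI v).
  have [|s0 sE] := prob (O v :|: I v) v; first by rewrite inE vO.
  have cU := cardsUI [set s | earliest (O v) v s] [set s | earliest (I v) v s].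
  rewrite cI in cU; move/(congr1 (fun k => k%:R : R)): cU; rewrite !natrD pE qE sE.
  move/(canRL (addrK _)) => ->.
  rewrite -mulrDr -mulrBr ler_pM2l // sum_w.
  have := @insertion_prob_ge R a #|O v|%:R #|I v|%:R #|O v :|: I v|%:R tau ha tau0.
  rewrite p0 q0 !ler_nat !subset_leq_card ?subsetUl ?subsetUr //=.
  rewrite -natrD ltr_nat -cardsUI -addn1 leq_add2l.
  have -> : (0 < #|O v :&: I v|)%N by apply/card_gt0P; exists v; rewrite inE vO vI.
  move=> /(_ isT isT isT); apply: le_trans; rewrite le_eqVlt.
  by apply/orP; left; apply/eqP; congr (_ - _ / _); field; rewrite gt_eqF.
have total : (\sum_v #|[set s | v \in sel s]|)%:R <= K * r%:R.
  rewrite /K -natrM ler_nat.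
  have -> : (\sum_v #|[set s | v \in sel s]| = \sum_(s : {perm T}) #|sel s|)%N.
    under eq_bigr do rewrite -sum1_card big_mkcond.
    rewrite exchange_big; apply: eq_bigr => s _ /=.
    rewrite -sum1_card [RHS]big_mkcond; apply: eq_bigr => v _; by rewrite inE.
  rewrite -sum_nat_const; exact: leq_sum.
have sumE (f : T -> R) : \sum_v (2 / tau - (n - f v / a) / tau ^+ 2) =
    2 / tau * n - (n * n - (\sum_v f v) / a) / tau ^+ 2.
  have nn : \sum_(v : T) n = n * n by rewrite sumr_const -mulr_natr.
  by rewrite sumrB sumr_const -[_ *+ #|_|]mulr_natr -nn
    [(\sum_v f v) / a]mulr_suml -sumrB mulr_suml.
have : \sum_v K * (2 / tau - (n - (\sum_u arc_weight e a v u) / a) / tau ^+ 2) <=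
    K * r%:R.
  by apply: le_trans total; rewrite natr_sum; apply: ler_sum.
rewrite -mulr_sumr ler_pM2l // sumE.
set W := \sum_v _ => h.
(* As n / tau = r, the averaged bound reads 2 r - (n^2 - W/a) / tau^2 <= r; multiplying by a tau^2
   gives the claim. *)
have -> : a * (1 - r%:R^-1) * n ^+ 2 = a * n ^+ 2 - r%:R * (a * tau ^+ 2).
  by rewrite /tau; field; rewrite gt_eqF.
have -> : W = a * n ^+ 2 +
    (2 / tau * n - (n * n - W / a) / tau ^+ 2) * (a * tau ^+ 2) - 2 * r%:R * (a * tau ^+ 2).
  by rewrite /tau; field; rewrite !gt_eqF.
have : (2 / tau * n - (n * n - W / a) / tau ^+ 2) * (a * tau ^+ 2) <=
    r%:R * (a * tau ^+ 2).
  by rewrite ler_pM2r // mulr_gt0 ?exprn_gt0.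
lra.
Qed.

(** * Sampling and the density of transitive tournaments *)

(** The values outside [h] are free. Samples of m vertices with repetition are maps from m points,
    and this gives the fibre sizes needed to average over them. *)
Lemma card_ffun_extensions (M V : finType) (h : seq M) (t : seq V) :
  uniq h -> size h = size t ->
  #|[set phi : {ffun M -> V} | map phi h == t]| = (#|V| ^ (#|M| - size h))%N.
Proof.
move=> uh ht.
(* [V] may be empty, so the candidate [u] itself is the default of [nth]; for x in [h] the index is
   in range and the default is never reached. *)
pose F x := [pred u | (x \in h) ==> (u == nth u t (index x h))].
have -> : #|[set phi : {ffun M -> V} | map phi h == t]| = #|family F|.
  apply: eq_card => phi; rewrite inE; apply/eqP/familyP => [phiE x|hF].
    rewrite inE -phiE; apply/implyP => xh.
    by rewrite (nth_map x) ?index_mem // nth_index.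
  case: t ht @F hF => [/size0nil -> //|v t] ht F hF.
  apply: (@eq_from_nth _ v); rewrite size_map // => i ih.
  have x0 : M by case: (h) ih.
  have := hF (nth x0 h i); rewrite inE mem_nth //= index_uniq // => /eqP hi.
  by rewrite (nth_map x0) // hi; apply: set_nth_default; rewrite -ht.
rewrite card_family foldrE big_map big_enum /=.
rewrite (bigID (mem h)) /= big1 ?mul1n => [|x xh]; last first.
  have : (index x h < size t)%N by rewrite -ht index_mem.
  move: @F; case: t ht => // v t ht F lt.
  rewrite (@eq_card1 _ (nth v (v :: t) (index x h))) // => u.
  rewrite -[LHS]/((x \in h) ==> (u == nth u (v :: t) (index x h))) xh.
  by rewrite (set_nth_default v u).
rewrite (eq_bigr (fun=> #|V|)) => [|x /negbTE xh]; last first.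
  by apply: eq_card => u; rewrite !inE xh.
rewrite prod_nat_const; congr (_ ^ _)%N.
by rewrite -(cardC (mem h)) (card_uniqP uh) addKn.
Qed.

Lemma sum_fibers (R : pzRingType) (X Y : finType) (p : X -> Y) (c : nat)
    (F : Y -> R) :
  (forall y, #|[set x | p x == y]| = c) -> \sum_x F (p x) = c%:R * \sum_y F y.
Proof.
move=> hp; rewrite (partition_big p predT) //= mulr_sumr; apply: eq_bigr => y _.
rewrite (eq_bigr (fun=> F y)) => [|x /eqP -> //].
rewrite sumr_const mulr_natl -(hp y); congr (_ *+ _).
by apply: eq_card => x; rewrite !inE.
Qed.

Lemma pairwise_irr_uniq (T : eqType) (e : rel T) (s : seq T) :
  irreflexive e -> pairwise e s -> uniq s.
Proof.
move=> e_irr; rewrite uniq_pairwise; apply: sub_pairwise => x y /=.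
by apply: contraTneq => ->; rewrite e_irr.
Qed.

Lemma arc_weight_le (R : realFieldType) (T : finType) (e : rel T) (a : R) u v :
  1 <= a -> arc_weight e a u v <= a.
Proof. by rewrite /arc_weight; case: (e u v); case: (e v u) => /=; lra. Qed.

(** The average weight of a sample exceeds the bound of [sum_arc_weight_le], so at least a fraction
    gamma / (2 a) of the n^m samples contain a tournament on r + 1 vertices. A given tuple occurs in
    at most m^(r+1) n^(m-r-1) samples. *)
Lemma tournaments_supersaturated (R : realFieldType) (V : finType) (e : rel V)
    (a gamma : R) (r m : nat) :
  irreflexive e -> 3 / 2 <= a -> (0 < r)%N -> (r < m)%N -> 0 < gamma ->
  a * (1 - r%:R^-1) + gamma <= gamma / 2 * m%:R ->
  (a * (1 - r%:R^-1) + gamma) * #|V|%:R ^+ 2 <= \sum_u \sum_v arc_weight e a u v ->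
  gamma / (2 * a * m%:R ^+ r.+1) * #|V|%:R ^+ r.+1 <=
    #|[set s : r.+1.-tuple V | pairwise e s]|%:R.
Proof.
move=> e_irr ha r0 rm g0 hm; set W := \sum_u _ => hW.
have [V0|V0] := posnP #|V|; first by rewrite V0 expr0n mulr0.
set n : R := #|V|%:R; have n0 : 0 < n by rewrite ltr0n.
have m0 : 0 < m%:R :> R by rewrite ltr0n (leq_ltn_trans _ rm).
have a0 : 0 < a by lra.
set E := [set s | _].
pose B := [set phi : {ffun 'I_m -> V} |
  [exists h : r.+1.-tuple 'I_m, uniq h && pairwise e (map phi h)]].
pose w (phi : {ffun 'I_m -> V}) i j := arc_weight e a (phi i) (phi j).
have w_le (phi : {ffun 'I_m -> V}) : \sum_i \sum_j w phi i j <=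
    a * (1 - r%:R^-1) * m%:R ^+ 2 + a * m%:R ^+ 2 * (phi \in B)%:R.
  case: (boolP (phi \in B)) => hB; rewrite ?mulr1 ?mulr0 ?addr0.
    apply: (@le_trans _ _ (\sum_(i < m) \sum_(j < m) a)).
      by apply: ler_sum => i _; apply: ler_sum => j _; apply: arc_weight_le; lra.
    rewrite !sumr_const !card_ord -mulrnA -[a *+ _]mulr_natr natrM -expr2 lerDr.
    by rewrite mulr_ge0 ?sqr_ge0 // mulr_ge0 ?subr_ge0 ?invf_le1 ?ler1n ?ltr0n // ltW.
  (* The relation pulled back along [phi] is still irreflexive on the m positions: repeated vertices
     just become non-adjacent positions. *)
  have := @sum_arc_weight_le R 'I_m (fun i j => e (phi i) (phi j)) a r.
  rewrite card_ord; apply=> // s hs; rewrite leqNgt; apply: contra hB => rs.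
  have sz : size (take r.+1 s) == r.+1 by rewrite size_takel.
  rewrite inE; apply/existsP; exists (Tuple sz); rewrite /= pairwise_map.
  have pt : pairwise (relpre phi e) (take r.+1 s).
    by apply: (subseq_pairwise (take_subseq _ _)).
  by rewrite pt andbT; apply: pairwise_irr_uniq pt => i; apply: e_irr.
pose X : R := n ^+ m; have X0 : 0 < X by apply: exprn_gt0.
have XE k : (k <= m)%N -> (#|V| ^ (m - k))%:R * n ^+ k = X.
  by move=> km; rewrite natrX -exprD subnK.
have sum_w i j : \sum_phi w phi i j = (#|V| ^ (m - 2))%:R * W *+ (i != j).
  have [->|ij] := eqVneq i j.
    by rewrite big1 // => phi _; rewrite /w /arc_weight e_irr mulr0 !addr0.
  rewrite /W pair_big /=.
  rewrite -(@sum_fibers R {ffun 'I_m -> V} _ (fun phi => (phi i, phi j)) _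
      (fun p => arc_weight e a p.1 p.2)) //.
  move=> [u v].
  have := @card_ffun_extensions _ _ [:: i; j] [:: u; v].
  rewrite /= inE ij card_ord => <- //.
  by apply: eq_card => phi; rewrite !inE xpair_eqE !eqseq_cons andbT.
have card_B : #|B|%:R <= m%:R ^+ r.+1 * ((#|V| ^ (m - r.+1))%:R * #|E|%:R) :> R.
  rewrite -!natrX -!natrM ler_nat.
  have -> : (m ^ r.+1 = #|{: r.+1.-tuple 'I_m}|)%N by rewrite card_tuple card_ord.
  rewrite -sum_nat_const.
  apply: (@leq_trans (\sum_(h : r.+1.-tuple 'I_m | uniq h)
      #|[set phi : {ffun 'I_m -> V} | pairwise e (map phi h)]|)).
    rewrite -sum1_card; under [leqRHS]eq_bigr do rewrite -sum1_card.
    rewrite (exchange_big_dep (mem B)) /=; last first.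
      by move=> h phi uh; rewrite !inE => ph; apply/existsP; exists h; rewrite uh.
    apply: leq_sum => phi; rewrite inE => /existsP[h /andP[uh ph]].
    by rewrite (bigD1 h) //= !inE uh ph.
  rewrite big_mkcond; apply: leq_sum => h _; case: ifP => // uh.
  have -> : #|[set phi : {ffun 'I_m -> V} | pairwise e (map phi h)]| =
     (\sum_(s in E) #|[set phi : {ffun 'I_m -> V} | map phi h == s]|)%N.
    rewrite -sum1_card (partition_big
      (fun phi : {ffun _ -> V} => map_tuple phi h) (mem E)) /=.
      apply: eq_bigr => s; rewrite inE => es; rewrite -sum1_card.
      apply: eq_bigl => phi; rewrite !inE -val_eqE /=.
      by apply: andb_idl => /eqP ->.
    by move=> phi; rewrite !inE.
  rewrite mulnC -sum_nat_const; apply: leq_sum => s _.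
  by rewrite card_ffun_extensions ?size_tuple ?card_ord.
have Bge : gamma / 2 * X <= a * #|B|%:R.
  have sumB : \sum_(phi : {ffun 'I_m -> V}) \sum_i \sum_j w phi i j <=
     a * (1 - r%:R^-1) * m%:R ^+ 2 * X + a * m%:R ^+ 2 * #|B|%:R.
    apply: le_trans (ler_sum _ (fun phi _ => w_le phi)) _.
    rewrite big_split /= sumr_const -mulr_sumr card_ffun card_ord.
    rewrite -[_ *+ _]mulr_natr natrX lerD2l sum_natr_pred.
    by rewrite (@eq_card _ [set _ | _] (mem B)) // => phi; rewrite inE.
  have sumE : \sum_(phi : {ffun 'I_m -> V}) \sum_i \sum_j w phi i j =
      m%:R * (m%:R - 1) * ((#|V| ^ (m - 2))%:R * W).
    rewrite exchange_big /=; under eq_bigr => i _.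
      rewrite exchange_big /=; under eq_bigr do rewrite sum_w -mulr_natr.
      rewrite -mulr_sumr sum_natr_pred (_ : [set j | i != j] = [set~ i]); last first.
        by apply/setP => j; rewrite !inE eq_sym.
      rewrite cardsC1 card_ord.
      over.
    rewrite sumr_const card_ord -[LHS]mulr_natl; case: (m) rm => // k _.
    by rewrite -mulrA; congr (_ * _); rewrite -natr1 addrK mulrC.
  rewrite sumE in sumB.
  have WX : (a * (1 - r%:R^-1) + gamma) * X <= (#|V| ^ (m - 2))%:R * W.
    rewrite -(XE 2%N) ?(leq_ltn_trans r0) // mulrCA ler_wpM2l //.
  have m1 : 0 <= m%:R - 1 :> R by rewrite subr_ge0 ler1n (leq_ltn_trans _ rm).
  have := ler_wpM2l (mulr_ge0 (ltW m0) m1) WX.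
  move=> /le_trans/(_ sumB) hB.
  have hmX := ler_wpM2l (ltW (mulr_gt0 m0 X0)) hm.
  (* The missing diagonal i = j costs m (A + gamma) X, which by [hm] is at most half of the gain
     gamma m^2 X. *)
  rewrite -(@ler_pM2l _ (m%:R ^+ 2)) ?exprn_gt0 //.
  set A := a * (1 - _) in hB hmX; nra.
have c0 : 0 < (#|V| ^ (m - r.+1))%:R :> R by rewrite ltr0n expn_gt0 V0.
have M0 : 0 < m%:R ^+ r.+1 :> R by rewrite exprn_gt0.
rewrite -(XE r.+1) // in Bge.
rewrite -(@ler_pM2l _ (a * m%:R ^+ r.+1 * (#|V| ^ (m - r.+1))%:R)) ?mulr_gt0 //.
have := le_trans Bge (ler_wpM2l (ltW a0) card_B).
congr (_ <= _); last by rewrite !mulrA.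
by set M := m%:R ^+ r.+1 in M0 *; field; rewrite !gt_eqF.
Qed.

(** * Blow-ups in dense families of tuples *)

(** The birthday bound on non-injective maps, in additive form and multiplied by n to avoid
    subtraction and the exponent t - 1. *)
Lemma expn_le_ffact (n t : nat) : (n * n ^ t <= n * n ^_ t + t ^ 2 * n ^ t)%N.
Proof.
elim: t => [|t IHt]; first by rewrite ffactn0 expn0 addn0.
have fle : (n ^_ t <= n ^ t)%N.
  elim: t {IHt} => // t IHt; rewrite ffactnSr expnSr leq_mul ?leq_subr //.
rewrite ffactnSr expnS.
have h : (n * n ^_ t <= n ^_ t * (n - t) + t * n ^ t)%N.
  apply: (@leq_trans (n ^_ t * (n - t) + t * n ^_ t)).
    by rewrite [(t * _)%N]mulnC -mulnDr mulnC leq_mul2l; apply/orP; right; lia.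
  by rewrite leq_add2l leq_mul2l fle orbT.
apply: (@leq_trans (n * (n * n ^_ t + t ^ 2 * n ^ t))).
  by rewrite leq_mul2l IHt orbT.
apply: (@leq_trans (n * (n ^_ t * (n - t) + t * n ^ t + t ^ 2 * n ^ t))).
  by rewrite leq_mul2l leq_add2r h orbT.
nia.
Qed.

Lemma card_noninj_ffun (T : finType) (t : nat) :
  (#|T| * #|[set z : {ffun 'I_t -> T} | ~~ injectiveb z]| <= t ^ 2 * #|T| ^ t)%N.
Proof.
have := cardsC [set z : {ffun 'I_t -> T} | injectiveb z].
rewrite card_inj_ffuns card_ffun card_ord.
have -> : ~: [set z : {ffun 'I_t -> T} | injectiveb z] =
    [set z : {ffun 'I_t -> T} | ~~ injectiveb z] by apply/setP => z; rewrite !inE.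
have := expn_le_ffact #|T| t; move=> + h; rewrite -{1}h mulnDr.
by rewrite leq_add2l.
Qed.

(** Kovari-Sos-Turan counting of pairs (z, y) with all z i adjacent to y. There are at least 2 delta
    n^t N of them, where delta = eps^(t+1) / 2; non-injective z account for fewer than half of this,
    so some injective z has at least delta N common neighbours. *)
Lemma common_neighbors (R : realFieldType) (V Y : finType) (E : V -> Y -> bool)
    (t : nat) (eps : R) : 0 < eps -> (0 < #|Y|)%N ->
  t%:R ^+ 2 < eps ^+ t.+1 / 2 * #|V|%:R ->
  2 * eps * #|V|%:R * #|Y|%:R <= #|[set p : V * Y | E p.1 p.2]|%:R ->
  exists2 z : 'I_t -> V, injective z &
    eps ^+ t.+1 / 2 * #|Y|%:R <= #|[set y | [forall i, E (z i) y]]|%:R.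
Proof.
set delta := eps ^+ t.+1 / 2; set n : R := #|V|%:R; set N : R := #|Y|%:R.
move=> eps0 Y0 ht hE.
have N0 : 0 < N by rewrite ltr0n.
have delta0 : 0 < delta by rewrite divr_gt0 ?exprn_gt0.
have n0 : 0 < n.
  by rewrite -(pmulr_rgt0 _ delta0); apply: le_lt_trans ht; rewrite sqr_ge0.
pose c (z : {ffun 'I_t -> V}) := #|[set y | [forall i, E (z i) y]]|.
have [/existsP[z /andP[/injectiveP z_inj cz]]|/existsPn none] :=
  boolP [exists z : {ffun 'I_t -> V}, injectiveb z && (delta * N <= (c z)%:R)].
  by exists z.
pose A y := [set x | E x y]; pose Y1 := [set y | eps * n <= #|A y|%:R].
have sumA : \sum_y #|A y|%:R = #|[set p : V * Y | E p.1 p.2]|%:R :> R.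
  rewrite -sum_natr_pred -(pair_bigA _ (fun x y => (E x y)%:R)) exchange_big /=.
  by apply: eq_bigr => y _; rewrite sum_natr_pred.
(* A degree threshold replaces convexity: vertices of degree below eps n carry at most half of the 2
   eps n N edges. *)
have Y1_ge : eps * N <= #|Y1|%:R.
  rewrite -(ler_pM2l n0).
  have : \sum_y #|A y|%:R <= \sum_y (n * (y \in Y1)%:R + eps * n) :> R.
    apply: ler_sum => y _; case: (boolP (y \in Y1)) => yY1.
      by rewrite mulr1 (@le_trans _ _ n) ?ler_nat ?max_card // lerDl mulr_ge0 ?ltW.
    by rewrite mulr0 add0r ltW // ltNge; move: yY1; rewrite inE.
  rewrite sumA big_split /= -mulr_sumr sum_natr_pred sumr_const.
  rewrite -[_ *+ #|_|]mulr_natr -/N.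
  rewrite (@eq_card _ [set _ | _] (mem Y1)) => [|y]; last by rewrite inE.
  move/(le_trans hE); lra.
have sum_c : \sum_z (c z)%:R = \sum_y #|A y|%:R ^+ t :> R.
  have cE z : (c z)%:R = \sum_y [forall i, E (z i) y]%:R :> R.
    by rewrite sum_natr_pred.
  under eq_bigr do rewrite cE.
  rewrite exchange_big /=; apply: eq_bigr => y _; rewrite sum_natr_pred.
  rewrite -natrX -[X in (_ ^ X)%N](card_ord t) -card_ffun_on; congr _%:R.
  apply: eq_card => z; rewrite inE; apply/forallP/ffun_onP => h i.
    by rewrite inE.
  by have := h i; rewrite inE.
have lower : 2 * delta * n ^+ t * N <= \sum_z (c z)%:R.
  rewrite sum_c (bigID (mem Y1)) /=.
  apply: (@le_trans _ _ (\sum_(y in Y1) (eps * n) ^+ t)).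
    rewrite sumr_const -[_ *+ #|_|]mulr_natr.
    have -> : 2 * delta * n ^+ t * N = (eps * n) ^+ t * (eps * N).
      by rewrite /delta exprS exprMn; field.
    by rewrite ler_pM2l ?exprn_gt0 ?mulr_gt0.
  rewrite -[leLHS]addr0 lerD //; last first.
    by apply: sumr_ge0 => y _; rewrite exprn_ge0.
  apply: ler_sum => y; rewrite inE => hy.
  by apply: lerXn2r; rewrite ?nnegrE ?mulr_ge0 // ltW.
have upper : \sum_z (c z)%:R <= delta * N * n ^+ t +
    N * #|[set z : {ffun 'I_t -> V} | ~~ injectiveb z]|%:R.
  apply: (@le_trans _ _ (\sum_(z : {ffun 'I_t -> V})
      (delta * N + N * (~~ injectiveb z)%:R))).
    apply: ler_sum => z _; have := none z; case: (injectiveb z) => /=.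
      by rewrite mulr0 addr0 -ltNge => /ltW.
    by rewrite mulr1 => _; rewrite (@le_trans _ _ N) ?ler_nat ?max_card // lerDr mulr_ge0 // ltW.
  rewrite big_split /= sumr_const -[_ *+ #|_|]mulr_natr card_ffun card_ord natrX.
  by rewrite -mulr_sumr sum_natr_pred.
have noninj : n * #|[set z : {ffun 'I_t -> V} | ~~ injectiveb z]|%:R <
    n * (delta * n ^+ t).
  rewrite [ltRHS]mulrCA mulrA.
  apply: (@le_lt_trans _ _ (t%:R ^+ 2 * n ^+ t)).
    by rewrite -!natrX -!natrM ler_nat card_noninj_ffun.
  by rewrite ltr_pM2r ?exprn_gt0.
rewrite ltr_pM2l // -(ltr_pM2l N0) in noninj.
have := le_trans lower upper; move=> h.
suff : N * (delta * n ^+ t) < N * (delta * n ^+ t) by rewrite ltxx.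
by apply: le_lt_trans noninj; lra.
Qed.

(** Erdos's induction on k: join first coordinates to the remaining k-tuples. Some t first
    coordinates have a dense set of common completions, to which the induction hypothesis applies.
    Disjointness of different classes is left to the application. *)
Lemma dense_tuples_contain_box (R : archiRealFieldType) (k t : nat) (eps : R) :
  0 < eps -> exists n0 : nat, forall (V : finType) (P : pred (seq V)),
    (n0 <= #|V|)%N -> eps * #|V|%:R ^+ k <= #|[set s : k.-tuple V | P s]|%:R ->
    exists2 f : nat -> 'I_t -> V, forall i, (i < k)%N -> injective (f i) &
      forall g : nat -> 'I_t, P (mkseq (fun i => f i (g i)) k).
Proof.
elim: k eps => [|k IHk] eps eps0.
  (* For k = 0 the values of [f] are unconstrained, but [V] must supply one; hence the threshold
     1. *)
  exists 1%N => V P V0; rewrite expr0 mulr1 => hP.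
  have /card_gt0P[s] : (0 < #|[set s : 0.-tuple V | P s]|)%N.
    by rewrite -(ltr0n R); apply: lt_le_trans hP.
  have /card_gt0P[v _] := V0.
  rewrite inE tuple0 => Pnil; exists (fun _ _ => v) => //.
pose delta := (eps / 2) ^+ t.+1 / 2.
have delta0 : 0 < delta by rewrite divr_gt0 ?exprn_gt0 ?divr_gt0.
have [n1 hn1] := IHk _ delta0.
pose n2 := Num.bound (t%:R ^+ 2 / delta).
exists (maxn n1 n2) => V P; rewrite geq_max => /andP[V1 V2] hP.
have ht : t%:R ^+ 2 < delta * #|V|%:R.
  rewrite mulrC -ltr_pdivrMr //.
  apply: (@lt_le_trans _ _ n2%:R); last by rewrite ler_nat.
  by apply: archi_boundP; rewrite divr_ge0 ?sqr_ge0 ?ltW.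
have V0 : (0 < #|V|)%N.
  rewrite -(ltr0n R) -(pmulr_rgt0 _ delta0); apply: le_lt_trans ht; exact: sqr_ge0.
have [||||z z_inj hz] :=
  @common_neighbors R V {: k.-tuple V} (fun x y => P (x :: y)) t (eps / 2).
- by rewrite divr_gt0.
- by rewrite card_tuple expn_gt0 V0.
- exact: ht.
- have -> : 2 * (eps / 2) = eps by field.
  rewrite card_tuple natrX -mulrA -exprS.
  apply: le_trans hP _; rewrite ler_nat.
  pose cut (s : k.+1.-tuple V) := (thead s, behead_tuple s).
  have cut_inj : injective cut.
    move=> s s' ss'; apply/val_inj; rewrite (tuple_eta s) (tuple_eta s') /=.
    by have /= -> := congr1 fst ss'; have /= -> := congr1 (val \o snd) ss'.
  rewrite -(card_imset _ cut_inj) subset_leq_card //.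
  apply/subsetP => p /imsetP[s + ->].
  by rewrite !inE {1}(tuple_eta s).
rewrite card_tuple natrX in hz.
have [f' f'_inj hf'] := hn1 V (fun y => [forall i, P (z i :: y)]) V1 hz.
exists (fun i => if i is j.+1 then f' j else z) => [[|i] // ik|g]; first exact: f'_inj.
have /forallP := hf' (fun i => g i.+1); move=> /(_ (g 0%N)); congr P.
by rewrite /mkseq /= (iotaDl 1 0) -map_comp.
Qed.

(** * Weight, Turan number and conclusion *)

Lemma sum_arc_weight (R : realType) (a : R) (G : digraph) :
  \sum_u \sum_v arc_weight (@Defs.arc G) a u v = 2 * weight a G.
Proof.
have irr := @arc_irrefl G.
have f1E : (f1 G * 2)%N =
    #|[set p : vertex G * vertex G | Defs.arc p.1 p.2 (+) Defs.arc p.2 p.1]|.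
  rewrite (card_unordered_pairs _ (fun u v => Defs.arc u v (+) Defs.arc v u)); last 2 first.
  - by move=> u v; rewrite addbC.
  - by move=> u; rewrite irr.
  congr (_ * 2)%N; apply: eq_card => A; rewrite !inE.
  apply: eq_existsb => u; apply: eq_existsb => v.
  by have [->|] := eqVneq u v; rewrite // irr /= andbF.
have f2E : (f2 G * 2)%N =
    #|[set p : vertex G * vertex G | Defs.arc p.1 p.2 && Defs.arc p.2 p.1]|.
  rewrite (card_unordered_pairs _ (fun u v => Defs.arc u v && Defs.arc v u)); last 2 first.
  - by move=> u v; rewrite andbC.
  - by move=> u; rewrite irr.
  congr (_ * 2)%N; apply: eq_card => A; rewrite !inE.
  apply: eq_existsb => u; apply: eq_existsb => v.
  by have [->|] := eqVneq u v; rewrite // irr /= andbF.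
have -> : 2 * weight a G = a * (f2 G * 2)%:R + (f1 G * 2)%:R.
  by rewrite /weight !natrM; ring.
rewrite f1E f2E -!sum_natr_pred mulr_sumr -big_split pair_bigA /=.
apply: eq_bigr => -[u v] _ /=; rewrite /arc_weight.
by case: (Defs.arc u v); case: (Defs.arc v u) => /=; ring.
Qed.

Lemma card_ord_modn (n r c : nat) : (0 < r)%N ->
  (#|[set j : 'I_n | j %% r == c]| <= (n %/ r).+1)%N.
Proof.
move=> r0.
pose q (j : 'I_n) : 'I_(n %/ r).+1 := inord (j %/ r).
rewrite -[X in (_ <= X)%N]card_ord -(card_in_imset (f := q)); first exact: max_card.
move=> i j; rewrite !inE => /eqP ic /eqP jc /(congr1 val) /=.
have qlt (k : 'I_n) : (k %/ r < (n %/ r).+1)%N by rewrite ltnS leq_div2r // ltnW.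
rewrite !inordK // => ij; apply/val_inj.
by rewrite /= (divn_eq i r) (divn_eq j r) ij ic jc.
Qed.

(** A vertex is non-adjacent only to its own residue class, of size at most n/r + 1; the rounding
    costs n in total. *)
Lemma turan_number_ge (R : realFieldType) (r n : nat) : (0 < r)%N ->
  (1 - r%:R^-1) * n%:R ^+ 2 - n%:R <= 2 * (turan_number r n)%:R :> R.
Proof.
move=> r0; have r0' : 0 < r%:R :> R by rewrite ltr0n.
have tE : (turan_number r n * 2)%N = #|[set p : 'I_n * 'I_n | turan_adj r p.1 p.2]|.
  rewrite (card_unordered_pairs _ (@turan_adj r n)) //.
  - by move=> i j; rewrite /turan_adj eq_sym.
  - by move=> i; rewrite /turan_adj eqxx.
rewrite [leRHS]mulrC -natrM tE -sum_natr_pred.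
rewrite -(pair_bigA _ (fun i j => (turan_adj r i j)%:R)) /=.
have -> : (1 - r%:R^-1) * n%:R ^+ 2 - n%:R =
    \sum_(i < n) (n%:R - (n%:R / r%:R + 1)) :> R.
  by rewrite sumr_const card_ord -[RHS]mulr_natr; ring.
apply: ler_sum => i _; rewrite sum_natr_pred.
have := cardsC [set j : 'I_n | (j %% r == i %% r)%N]; rewrite card_ord.
have -> : ~: [set j : 'I_n | (j %% r == i %% r)%N] = [set j | turan_adj r i j].
  by apply/setP => j; rewrite !inE /turan_adj eq_sym.
move/(congr1 (fun k => k%:R : R)); rewrite natrD => nE.
have le1 : #|[set j : 'I_n | (j %% r == i %% r)%N]|%:R <= n%:R / r%:R + 1 :> R.
  apply: (@le_trans _ _ (n %/ r).+1%:R); first by rewrite ler_nat card_ord_modn.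
  rewrite -natr1 lerD2r ler_pdivlMr // -natrM ler_nat; exact: leq_divM.
lra.
Qed.

Theorem theorem3p1 (R : realType) (r t : nat) (a gamma : R)
  (hr : (1 <= r)%N) (ht : (1 <= t)%N)
  (ha : 3 / 2 < a) (ha2 : a <= 2) (hgamma : 0 < gamma) :
  exists n0 : nat, forall n : nat, (n0 <= n)%N ->
    forall G : digraph, #|vertex G| = n ->
      a * (turan_number r n)%:R + gamma * n%:R ^+ 2 <= weight a G ->
      contains G (blowup (transitive_tournament r.+1) t).
Proof.
have a0 : 0 < a by lra.
pose A := a * (1 - r%:R^-1).
have A0 : 0 <= A.
  by rewrite mulr_ge0 ?subr_ge0 ?invf_le1 ?ler1n ?ltr0n // ltW.
pose m := maxn r.+1 (Num.bound ((A + gamma) / (gamma / 2))).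
have hm : A + gamma <= gamma / 2 * m%:R.
  have g2 : 0 < gamma / 2 by rewrite divr_gt0.
  rewrite mulrC -ler_pdivrMr //.
  apply: (@le_trans _ _ (Num.bound ((A + gamma) / (gamma / 2)))%:R).
    by apply/ltW/archi_boundP; rewrite divr_ge0 ?addr_ge0 // ltW.
  by rewrite ler_nat leq_maxr.
have m0 : 0 < m%:R :> R by rewrite ltr0n leq_max.
have eps0 : 0 < gamma / (2 * a * m%:R ^+ r.+1).
  by rewrite divr_gt0 ?mulr_gt0 ?exprn_gt0.
have [n1 hn1] := dense_tuples_contain_box _ r.+1 t _ eps0.
(* From here on the rounding loss a n is at most gamma n^2, half of the excess 2 gamma n^2 in the
   sum over ordered pairs. *)
pose n2 := Num.bound (a / gamma).
exists (maxn n1 n2) => n; rewrite geq_max => /andP[n1n n2n] G Gn hG.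
have irr := @arc_irrefl G.
have gn : a <= gamma * n%:R.
  rewrite mulrC -ler_pdivrMr //.
  apply: (@le_trans _ _ n2%:R); last by rewrite ler_nat.
  by apply/ltW/archi_boundP; rewrite divr_ge0 // ltW.
have dense : (A + gamma) * #|vertex G|%:R ^+ 2 <=
    \sum_u \sum_v arc_weight (@Defs.arc G) a u v.
  rewrite sum_arc_weight Gn.
  have := ler_wpM2l (ltW a0) (turan_number_ge R r n hr).
  have := ler_wpM2r (ler0n R n) gn.
  rewrite /A; nra.
have rm : (r < m)%N by rewrite leq_maxl.
have [|f f_inj hf] := hn1 _ (pairwise (@Defs.arc G)) _
    (tournaments_supersaturated _ _ _ _ _ _ _ irr (ltW ha) hr rm hgamma hm dense).
  by rewrite Gn.
have f_arc (i j : 'I_r.+1) x y : (i < j)%N -> Defs.arc (f i x) (f j y).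
  move=> ij; pose g (k : nat) := if k == i then x else y.
  have := hf g => /(pairwiseP (f 0%N x))/(_ i j).
  rewrite !inE !size_mkseq !nth_mkseq ?size_mkseq //.
  by move=> /(_ (ltn_ord i) (ltn_ord j) ij); rewrite /g eqxx gtn_eqF.
exists (fun p : vertex (blowup (transitive_tournament r.+1) t) => f p.1 p.2).
  (* Different classes are disjoint, since a common vertex would carry a loop. *)
  move=> [i x] [j y] /= fE; case: (ltngtP i j) => [ij|ji|/val_inj ij].
  - by have := f_arc i j x y ij; rewrite fE irr.
  - by have := f_arc j i y x ji; rewrite fE irr.
  - by move: fE; rewrite ij => /f_inj ->.
by move=> [i x] [j y] /= ij; apply: f_arc.
Qed.
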